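(* Consider the optimistic bilevel optimization problem (OBOP), its Mond--Weir dual reformulation (MWD), and the mapping $K_{\mathrm{mw}}$, all as defined in the context. (a) Let $(\bar x,\bar y)\in\mathbb{R}^n\times\mathbb{R}^m$ be a global minimizer of (OBOP). Then, for each $(\bar z,\bar u)\in K_{\mathrm{mw}}(\bar x,\bar y)$, the point $(\bar x,\bar y,\bar z,\bar u)$ is a global minimizer of (MWD). (b) Let $(\bar x,\bar y,\bar z,\bar u)\in\mathbb{R}^n\times\mathbb{R}^m\times\mathbb{R}^m\times\mathbb{R}^p$ be a global minimizer of (MWD). Assume that, for each $x\in X\cap\operatorname{dom}\Psi$, there exists some point in $\Psi(x)$ where GCQ holds for the lower-level problem $(P(x))$. Then $(\bar x,\bar y)$ is a global minimizer of (OBOP).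
   Context: Let $f\colon\mathbb{R}^n\times\mathbb{R}^m\to\mathbb{R}$ and $g\colon\mathbb{R}^n\times\mathbb{R}^m\to\mathbb{R}^p$ be twice continuously differentiable, $F\colon\mathbb{R}^n\times\mathbb{R}^m\to\mathbb{R}$ continuously differentiable, and $X\subset\mathbb{R}^n$ nonempty and closed. For each $x\in X$, the functions $f(x,\cdot),g_1(x,\cdot),\ldots,g_p(x,\cdot)$ are convex. Vector inequalities are componentwise. Lower-level problem $(P(x))$: $\min_y\{f(x,y)\mid g(x,y)\le 0\}$. Its value function is $\varphi(x):=\inf_y\{f(x,y)\mid g(x,y)\le 0\}\in\mathbb{R}\cup\{\pm\infty\}$, and its solution mapping is $\Psi(x):=\{y\in\mathbb{R}^m\mid g(x,y)\le 0,\ f(x,y)\le\varphi(x)\}$, with $\operatorname{dom}\Psi:=\{x\mid\Psi(x)\neq\emptyset\}$. (OBOP): $\min_{x,y}\{F(x,y)\mid x\in X,\ y\in\Psi(x)\}$. Lower-level Lagrangian: $L(x,y,u):=f(x,y)+u^\top g(x,y)$; $\nabla_2L$ denotes its gradient with respect to the second argument. (MWD): $\min_{x,y,z,u}\{F(x,y)\mid x\in X,\ g(x,y)\le 0,\ u\ge 0,\ f(x,y)\le f(x,z),\ u^\top g(x,z)\ge 0,\ \nabla_2L(x,z,u)=0\}$ with $(x,y,z,u)\in\mathbb{R}^n\times\mathbb{R}^m\times\mathbb{R}^m\times\mathbb{R}^p$. $K_{\mathrm{mw}}\colon\mathbb{R}^n\times\mathbb{R}^m\rightrightarrows\mathbb{R}^m\times\mathbb{R}^p$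 is $K_{\mathrm{mw}}(x,y):=\{(z,u)\mid g(x,y)\le 0,\ u\ge 0,\ f(x,y)\le f(x,z),\ u^\top g(x,z)\ge 0,\ \nabla_2L(x,z,u)=0\}$. GCQ (as defined here) holds for $(P(x))$ at a point $y$ with $g(x,y)\le 0$ if the tangent cone $T(y)$ to $\Gamma(x):=\{y'\in\mathbb{R}^m\mid g(x,y')\le 0\}$ at $y$ satisfies $T(y)=\{d\in\mathbb{R}^m\mid \nabla_y g_i(x,y)^\top d\le 0\ \text{for all } i \text{ with } g_i(x,y)=0\}$, where $T(y)$ is the set of all $d$ for which there exist $y^k\in\Gamma(x)$ and $t_k>0$ with $y^k\to y$, $t_k\downarrow 0$, $(y^k-y)/t_k\to d$. *)

(* Defs.v *)
From HB Require Import structures.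
From mathcomp Require Import all_boot all_order all_algebra.
From mathcomp Require Import all_classical all_reals all_analysis.

Set Implicit Arguments.
Unset Strict Implicit.
Unset Printing Implicit Defensive.

Import Order.TTheory GRing.Theory Num.Theory.
Import numFieldNormedType.Exports.

Local Open Scope classical_set_scope.
Local Open Scope ring_scope.

Definition vle (R : realType) (p : nat) (a b : 'cV[R]_p) : Prop :=
  forall i, a i 0 <= b i 0.

Definition dot (R : realType) (p : nat) (a b : 'cV[R]_p) : R :=
  (a^T *m b) 0 0.

Definition gradient (R : realType) (m : nat) (h : 'cV[R]_m -> R)
    (y : 'cV[R]_m) : 'cV[R]_m :=
  \col_j 'D_(delta_mx j 0) h y.

(* The domain is finite-dimensional, so continuity of every directional
   derivative is the same as continuity of the differential 'd h in the
   operator norm. *)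
Definition C1 (R : realType) (n m : nat) (W : normedModType R)
    (h : 'cV[R]_n * 'cV[R]_m -> W) : Prop :=
  (forall w, differentiable h w) /\ (forall v, continuous ('D_v h)).

Definition C2 (R : realType) (n m : nat) (W : normedModType R)
    (h : 'cV[R]_n * 'cV[R]_m -> W) : Prop :=
  C1 h /\ (forall v, C1 ('D_v h)).

Definition global_minimizer (R : realType) (T : Type) (S : set T)
    (F : T -> R) (w0 : T) : Prop :=
  S w0 /\ forall w, S w -> F w0 <= F w.

Section Bilevel.
Variables (R : realType) (n m p : nat).
Implicit Types (f F : 'cV[R]_n * 'cV[R]_m -> R)
  (g : 'cV[R]_n * 'cV[R]_m -> 'cV[R]_p) (X : set 'cV[R]_n)
  (x : 'cV[R]_n) (y z : 'cV[R]_m) (u : 'cV[R]_p).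

Definition Gamma g x : set 'cV[R]_m := [set y | vle (g (x, y)) 0].

Definition value_function f g x : \bar R :=
  ereal_inf [set (f (x, y))%:E | y in Gamma g x].

Definition Psi f g x : set 'cV[R]_m :=
  [set y | vle (g (x, y)) 0 /\ ((f (x, y))%:E <= value_function f g x)%E].

Definition dom_Psi f g : set 'cV[R]_n := [set x | Psi f g x !=set0].

Definition OBOP_feasible f g X : set ('cV[R]_n * 'cV[R]_m) :=
  [set w | X w.1 /\ Psi f g w.1 w.2].

Definition OBOP_minimizer f g F X x y : Prop :=
  global_minimizer (OBOP_feasible f g X) F (x, y).

Definition lagrangian f g x y u : R := f (x, y) + dot u (g (x, y)).

Definition grad2_lagrangian f g x z u : 'cV[R]_m :=
  gradient (fun y => lagrangian f g x y u) z.

Definition K_mw f g x y : set ('cV[R]_m * 'cV[R]_p) :=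
  [set zu | let: (z, u) := zu in
    [/\ vle (g (x, y)) 0, vle 0 u, f (x, y) <= f (x, z),
        0 <= dot u (g (x, z)) & grad2_lagrangian f g x z u = 0]].

Definition MWD_feasible f g X :
    set ('cV[R]_n * 'cV[R]_m * 'cV[R]_m * 'cV[R]_p) :=
  [set w | let: (x, y, z, u) := w in
    X x /\
    [/\ vle (g (x, y)) 0, vle 0 u, f (x, y) <= f (x, z),
        0 <= dot u (g (x, z)) & grad2_lagrangian f g x z u = 0]].

Definition MWD_minimizer f g F X x y z u : Prop :=
  global_minimizer (MWD_feasible f g X)
    (fun w => let: (x', y', _, _) := w in F (x', y')) (x, y, z, u).

Definition tangent_cone (C : set 'cV[R]_m) y : set 'cV[R]_m :=
  [set d | exists (yk : nat -> 'cV[R]_m) (t : nat -> R),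
    [/\ forall k, C (yk k), forall k, 0 < t k,
        yk @ \oo --> y, t @ \oo --> (0 : R) &
        (fun k => (t k)^-1 *: (yk k - y)) @ \oo --> d]].

Definition linearized_cone g x y : set 'cV[R]_m :=
  [set d | forall i : 'I_p, g (x, y) i 0 = 0 ->
    dot (gradient (fun y' => g (x, y') i 0) y) d <= 0].

(* Full equality of the two cones, not merely of their polars. *)
Definition GCQ g x y : Prop :=
  vle (g (x, y)) 0 /\ tangent_cone (Gamma g x) y = linearized_cone g x y.

End Bilevel.

(* Main.v *)
Require Import Defs.
From HB Require Import structures.
From mathcomp Require Import all_boot all_order all_algebra.
From mathcomp Require Import all_classical all_reals all_analysis.
From mathcomp Require Import ring.

(** Both parts compare feasible sets: it is enough to know when a pair (x, y)
is the projection of a feasible point of the Mond-Weir program, because F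
depends on (x, y) only.

Every feasible (x, y, z, u) projects into the graph of Psi
([mw_weak_duality]).  Since u is nonnegative, the lower-level Lagrangian at u
is convex in y, so that its stationary point z minimizes it
([lagrangian_stationary_min]); hence, for each y' in Gamma g x,
f (x, y) <= f (x, z) <= L (x, z, u) <= L (x, y', u) <= f (x, y').
This settles (a), and the feasibility claim in (b).

For (b) one also needs that every bilevel feasible (x, y) lifts.  Take a
lower-level solution y1 at which GCQ holds.  Minimality makes the derivative of f
nonnegative on the tangent cone ([tangent_cone_diff_ge0]), which GCQ identifies
with the linearized cone, and Farkas' lemma ([farkas_lemma]) turns this into
multipliers u with complementary slackness and a stationary Lagrangian
([gcq_multiplier]).  As y and y1 have the same optimal value, (x, y, y1, u) is
feasible, with the multiplier attached to y1 rather than to y.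

All limits come from one fact, [cvg_difference_quotient]: for a differentiable
function, difference quotients along varying directions converge.  With a fixed
direction it yields the gradient inequality for convex functions, with the
directions of a tangent sequence it yields the first-order condition on the
tangent cone. *)

Set Implicit Arguments.
Unset Strict Implicit.
Unset Printing Implicit Defensive.

Import Order.TTheory GRing.Theory Num.Theory.
Import numFieldNormedType.Exports.

Local Open Scope classical_set_scope.
Local Open Scope ring_scope.

(** * Dot product and Farkas' lemma *)

Lemma dotE (R : realType) (p : nat) (a b : 'cV[R]_p) :
  dot a b = \sum_i a i 0 * b i 0.
Proof. by rewrite /dot mxE; apply: eq_bigr => i _; rewrite mxE. Qed.

Lemma dotDl (R : realType) (p : nat) (a b d : 'cV[R]_p) :
  dot (a + b) d = dot a d + dot b d.
Proof. by rewrite /dot linearD mulmxDl mxE. Qed.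

Lemma dotZl (R : realType) (p : nat) (c : R) (a d : 'cV[R]_p) :
  dot (c *: a) d = c * dot a d.
Proof. by rewrite /dot linearZ -scalemxAl mxE. Qed.

Lemma dotNl (R : realType) (p : nat) (a d : 'cV[R]_p) :
  dot (- a) d = - dot a d.
Proof. by rewrite -scaleN1r dotZl mulN1r. Qed.

Lemma dotBr (R : realType) (p : nat) (a d e : 'cV[R]_p) :
  dot a (d - e) = dot a d - dot a e.
Proof. by rewrite /dot mulmxBr !mxE. Qed.

Lemma dotZr (R : realType) (p : nat) (c : R) (a d : 'cV[R]_p) :
  dot a (c *: d) = c * dot a d.
Proof. by rewrite /dot -scalemxAr mxE. Qed.

Lemma dot0l (R : realType) (p : nat) (d : 'cV[R]_p) : dot 0 d = 0.
Proof. by rewrite -(scale0r 0) dotZl mul0r. Qed.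

Lemma dot_suml (R : realType) (p : nat) (I : finType) (a : I -> 'cV[R]_p)
  (d : 'cV[R]_p) : dot (\sum_i a i) d = \sum_i dot (a i) d.
Proof. by rewrite /dot linear_sum /= mulmx_suml summxE. Qed.

Lemma dot_delta (R : realType) (p : nat) (a : 'cV[R]_p) j :
  dot a (delta_mx j 0) = a j 0.
Proof.
rewrite dotE (bigD1 j) //= mxE !eqxx mulr1 big1 ?addr0 // => i ij.
by rewrite mxE (negbTE ij) mulr0.
Qed.

(** Bartl's induction on the number of constraints, which is purely algebraic
and so avoids proving that finitely generated cones are closed.  If the last
constraint e is redundant, induction applies directly.  Otherwise some d0
satisfies the other constraints but violates both e and the conclusion;
projecting all vectors along e so that they become orthogonal to d0 removes e
from the system. *)
Lemma farkas_lemma (R : realType) (m k : nat) (a : 'I_k -> 'cV[R]_m)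
    (b : 'cV[R]_m) :
  (forall d, (forall i, dot (a i) d <= 0) -> dot b d <= 0) ->
  exists2 u : 'I_k -> R, forall i, 0 <= u i & b = \sum_i u i *: a i.
Proof.
elim: k a b => [|k IH] a b ab.
  exists (fun=> 0) => //; rewrite big_ord0; apply/matrixP => i j.
  rewrite ord1 mxE -dot_delta; apply/le_anti/andP; split.
    by apply: ab => -[].
  by rewrite -oppr_le0 -mulN1r -dotZr; apply: ab => -[].
pose a' i := a (lift ord_max i); pose e := a ord_max.
have [b'le|] :=
  pselect (forall d, (forall i, dot (a' i) d <= 0) -> dot b d <= 0).
  have [u u0 ->] := IH _ _ b'le.
  exists (fun i => if unlift ord_max i is Some j then u j else 0) => [i|].
    by case: unlift.
  rewrite (bigD1_ord ord_max)//= unlift_none scale0r add0r.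
  by apply: eq_bigr => i _; rewrite liftK.
move=> /existsNP[d0 /not_implyP[a'd0 /negP]]; rewrite -ltNge => bd0.
have ed0 : 0 < dot e d0.
  rewrite ltNge; apply/negP => ed0; move: bd0; rewrite ltNge => /negP; apply.
  apply: ab => i; case: (unliftP ord_max i) => [j|] -> //.
  exact: a'd0.
(* Pairing [proj c] with d amounts to pairing c with the point d' where the line
   through d in direction d0 meets the hyperplane orthogonal to e, so the last
   constraint holds at d' with equality. *)
pose proj (c : 'cV[R]_m) := c - (dot c d0 / dot e d0) *: e.
have [|u u0 bE] := IH (fun i => proj (a' i)) (proj b).
  move=> d a'd.
  pose d' := d - (dot e d / dot e d0) *: d0.
  have projE c : dot (proj c) d = dot c d'.
    rewrite /proj /d' dotDl dotNl dotZl dotBr dotZr.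
    by congr (_ - _); ring.
  rewrite projE; apply: ab => i; case: (unliftP ord_max i) => [j|] -> //.
    by rewrite -projE; exact: a'd.
  by rewrite /d' dotBr dotZr -mulrA mulVf ?gt_eqF// mulr1 subrr.
(* The coefficient that undoes the projection; it is nonnegative because d0
   separates b from the constraints a'. *)
pose t := (dot b d0 - \sum_i u i * dot (a' i) d0) / dot e d0.
exists (fun i => if unlift ord_max i is Some j then u j else t) => [i|].
  case: unlift => [j|] //; apply: divr_ge0; last exact: ltW.
  rewrite subr_ge0; apply: (@le_trans _ _ 0); last exact: ltW.
  by apply: sumr_le0 => i0 _; rewrite mulr_ge0_le0.
rewrite (bigD1_ord ord_max)//= unlift_none.
under eq_bigr do rewrite liftK.
have sumE : \sum_i u i *: proj (a' i) =
    \sum_i u i *: a' i - (\sum_i u i * dot (a' i) d0) / dot e d0 *: e.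
  rewrite mulr_suml scaler_suml -sumrB; apply: eq_bigr => i _.
  by rewrite /proj scalerBr scalerA mulrA.
rewrite -[LHS](subrK ((dot b d0 / dot e d0) *: e)) -/(proj b) bE /= sumE.
by rewrite /t mulrBl scalerBl [RHS]addrC -addrA [- _ + _]addrC.
Qed.

(** * Differentials along sequences and convexity *)

Lemma diff_dot_gradient (R : realType) (m : nat) (h : 'cV[R]_m -> R)
    (y v : 'cV[R]_m) :
  differentiable h y -> 'd h y v = dot (gradient h y) v.
Proof.
move=> dh; have -> : v = \sum_j v j 0 *: delta_mx j 0.
  by rewrite [LHS]matrix_sum_delta; apply: eq_bigr => j _; rewrite big_ord1.
rewrite linear_sum dotE; apply: eq_bigr => j _.
rewrite linearZ /= mxE deriveE// mulrC; congr (_ * _).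
rewrite summxE (bigD1 j) //= !mxE !eqxx mulr1 big1 ?addr0 // => i ij.
by rewrite !mxE eq_sym (negbTE ij) mulr0.
Qed.

(** Frechet differentiability is what allows the direction to vary with k: the
remainder at t k *: dk k is o(t k) because the converging directions are
bounded. *)
Lemma cvg_difference_quotient (R : realType) (V : normedModType R)
    (h : V -> R) (z d : V) (t : nat -> R) (dk : nat -> V) :
  differentiable h z -> (forall k, 0 < t k) -> t @ \oo --> (0 : R) ->
  dk @ \oo --> d ->
  (fun k => (t k)^-1 * (h (t k *: dk k + z) - h z)) @ \oo --> 'd h z d.
Proof.
move=> dh t0 tcv dcv.
pose r w := h (w + z) - h z - 'd h z w.
have r_small eps : 0 < eps -> \forall w \near (0 : V), `|r w| <= eps * `|w|.
  move=> eps0; near=> w.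
  rewrite /r (diff_locallyx dh) -addrA -opprD [X in X - _]addrC addrK.
  by near: w; exact: littleoP.
have wcv : (fun k => t k *: dk k) @ \oo --> (0 : V).
  by rewrite -(scale0r d); apply: cvgZ.
have rcv : (fun k => (t k)^-1 * r (t k *: dk k)) @ \oo --> (0 : R).
  apply/cvgr0Pnorm_le => eps eps0.
  have d1 : 0 < `|d| + 1 by rewrite ltr_wpDl.
  have e0 : 0 < eps / (`|d| + 1) by rewrite divr_gt0.
  near=> k.
  rewrite normrM gtr0_norm ?invr_gt0 // ler_pdivrMl //.
  have rk : `|r (t k *: dk k)| <= eps / (`|d| + 1) * `|t k *: dk k|.
    near: k; exact: (wcv _ (r_small _ e0)).
  apply: le_trans rk _; rewrite normrZ gtr0_norm // mulrCA ler_pM2l //.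
  rewrite mulrAC ler_pdivrMr // ler_pM2l //.
  near: k; apply: (cvgr_le `|d|); last by rewrite ltrDl.
  exact: cvg_norm.
have dcv' : (fun k => 'd h z (dk k)) @ \oo --> 'd h z d.
  have dc : {for d, continuous ('d h z)} by exact: diff_continuous.
  exact: (cvg_comp _ _ dcv dc).
rewrite -[X in _ --> X]addr0.
apply: cvg_trans (cvgD dcv' rcv); apply: near_eq_cvg; near=> k => /=.
rewrite /r !fctE linearZ /= -[_ *: 'd h z _]/(_ * _) mulrBr.
by rewrite mulKf ?gt_eqF // addrC subrK.
Unshelve. all: by end_near. Qed.

(** By convexity the difference quotients at z in direction y - z with step at
most 1 are bounded by h y - h z; their limit is the directional derivative. *)
Lemma convex_gradient_le (R : realType) (V : normedModType R) (h : V -> R)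
    (z y : V) :
  convex_function setT h -> differentiable h z ->
  h z + 'd h z (y - z) <= h y.
Proof.
move=> hconv dh; rewrite addrC -lerBrDr.
have ccv : (fun _ : nat => y - z) @ \oo --> y - z by exact: cvg_cst.
have := cvg_difference_quotient dh (@harmonic_gt0 R) cvg_harmonic ccv.
move/cvgr_to_le; apply; near=> k.
have t0 : 0 < harmonic k :> R by exact: harmonic_gt0.
have t1 : harmonic k <= 1 :> R by rewrite /harmonic invf_le1 ?ler1n.
rewrite ler_pdivrMl // lerBlDr.
have := hconv (Itv01 (ltW t0) t1) y z; rewrite !inE => /(_ Logic.I Logic.I).
set c : V := (X in h X <= _); have -> : c = harmonic k *: (y - z) + z.
  rewrite -[c]/(harmonic k *: y + (1 - harmonic k) *: z).
  by rewrite scalerBr scalerBl scale1r addrA addrAC.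
move/le_trans; apply; rewrite convRE /unstable.onem /= -/(harmonic k).
by rewrite le_eqVlt; apply/orP; left; apply/eqP; ring.
Unshelve. all: by end_near. Qed.

(** Along a tangent sequence the difference quotients of h are nonnegative. *)
Lemma tangent_cone_diff_ge0 (R : realType) (m : nat) (C : set 'cV[R]_m)
    (h : 'cV[R]_m -> R) (y d : 'cV[R]_m) :
  differentiable h y -> (forall y', C y' -> h y <= h y') ->
  tangent_cone C y d -> 0 <= 'd h y d.
Proof.
move=> dh ymin [yk [t [Cyk t0 ykcv tcv dcv]]].
have := cvg_difference_quotient dh t0 tcv dcv.
move/cvgr_to_ge; apply; near=> k.
apply: mulr_ge0; first by rewrite invr_ge0 ltW.
rewrite scalerA mulfV ?gt_eqF // scale1r subrK subr_ge0; exact: ymin.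
Unshelve. all: by end_near. Qed.

(** * Lower-level duality *)

Lemma grad2_lagrangianE (R : realType) (n m p : nat)
    (f : 'cV[R]_n * 'cV[R]_m -> R) (g : 'cV[R]_n * 'cV[R]_m -> 'cV[R]_p)
    (x : 'cV[R]_n) (z : 'cV[R]_m) (u : 'cV[R]_p) :
  differentiable (fun y => f (x, y)) z ->
  (forall i, differentiable (fun y => g (x, y) i 0) z) ->
  grad2_lagrangian f g x z u =
    gradient (fun y => f (x, y)) z +
    \sum_i u i 0 *: gradient (fun y => g (x, y) i 0) z.
Proof.
move=> df dg; apply/matrixP => j j'; rewrite !mxE summxE.
have -> : (fun y => lagrangian f g x y u) =
    (fun y => f (x, y)) + \sum_(i < p) (u i 0 \*: (fun y => g (x, y) i 0)).
  by apply/funext => y; rewrite /lagrangian dotE !fctE fct_sumE.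
have dug i : derivable (u i 0 \*: (fun y => g (x, y) i 0)) z (delta_mx j 0).
  exact/derivableZ/diff_derivable.
rewrite deriveD; [|exact: diff_derivable|exact: derivable_sum].
rewrite derive_sum //; congr (_ + _); apply: eq_bigr => i _.
by rewrite deriveZ ?mxE //; exact: diff_derivable.
Qed.

(** Adding the gradient inequalities of f and of the g i, weighted by u, leaves
the gradient of the Lagrangian as the only first-order term. *)
Lemma lagrangian_stationary_min (R : realType) (n m p : nat)
    (f : 'cV[R]_n * 'cV[R]_m -> R) (g : 'cV[R]_n * 'cV[R]_m -> 'cV[R]_p)
    (x : 'cV[R]_n) (z : 'cV[R]_m) (u : 'cV[R]_p) :
  differentiable (fun y => f (x, y)) z ->
  (forall i, differentiable (fun y => g (x, y) i 0) z) ->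
  convex_function setT (fun y => f (x, y)) ->
  (forall i, convex_function setT (fun y => g (x, y) i 0)) ->
  vle 0 u -> grad2_lagrangian f g x z u = 0 ->
  forall y, lagrangian f g x z u <= lagrangian f g x y u.
Proof.
move=> df dg fconv gconv u0 gradL0 y.
have fle := convex_gradient_le y fconv df.
have gle i := convex_gradient_le y (gconv i) (dg i).
rewrite /lagrangian !dotE.
have : dot (grad2_lagrangian f g x z u) (y - z) = 0 by rewrite gradL0 dot0l.
rewrite grad2_lagrangianE // dotDl dot_suml -diff_dot_gradient // => eq0.
rewrite -[leLHS]addr0 -[X in _ + X <= _]eq0 addrACA.
apply: lerD; first exact: fle.
rewrite -big_split /=.
apply: ler_sum => i _; rewrite dotZl -mulrDr ler_wpM2l //.
  by have := u0 i; rewrite mxE.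
by rewrite -diff_dot_gradient.
Qed.

(** Mond-Weir weak duality: f (x, z) bounds the lower-level value function from
below, and f (x, y) <= f (x, z), so y is optimal. *)
Lemma mw_weak_duality (R : realType) (n m p : nat)
    (f : 'cV[R]_n * 'cV[R]_m -> R) (g : 'cV[R]_n * 'cV[R]_m -> 'cV[R]_p)
    (x : 'cV[R]_n) (y z : 'cV[R]_m) (u : 'cV[R]_p) :
  differentiable (fun y => f (x, y)) z ->
  (forall i, differentiable (fun y => g (x, y) i 0) z) ->
  convex_function setT (fun y => f (x, y)) ->
  (forall i, convex_function setT (fun y => g (x, y) i 0)) ->
  K_mw f g x y (z, u) -> Psi f g x y.
Proof.
move=> df dg fconv gconv [gy u0 fyz ugz gradL0]; split=> //.
apply/ereal_infP => _ [y' gy' <-]; rewrite lee_fin.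
apply: (le_trans fyz).
have := lagrangian_stationary_min df dg fconv gconv u0 gradL0 y'.
rewrite /lagrangian => Lle.
have : f (x, z) <= f (x, z) + dot u (g (x, z)) by rewrite lerDl.
move/le_trans; apply; apply: (le_trans Lle).
rewrite gerDl dotE; apply: sumr_le0 => i _.
have := u0 i; have := gy' i; rewrite !mxE => gi ui; exact: mulr_ge0_le0.
Qed.

Lemma Psi_le (R : realType) (n m p : nat)
    (f : 'cV[R]_n * 'cV[R]_m -> R) (g : 'cV[R]_n * 'cV[R]_m -> 'cV[R]_p)
    (x : 'cV[R]_n) (y y' : 'cV[R]_m) :
  Psi f g x y -> Gamma g x y' -> f (x, y) <= f (x, y').
Proof.
move=> [_ fy] gy'; rewrite -lee_fin; apply: (le_trans fy).
by apply: ereal_inf_lbound; exists y'.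
Qed.

(** The Karush-Kuhn-Tucker conditions: GCQ says that every direction of the
linearized cone is tangent, so that Farkas' lemma applies to the active
gradients. *)
Lemma gcq_multiplier (R : realType) (n m p : nat)
    (f : 'cV[R]_n * 'cV[R]_m -> R) (g : 'cV[R]_n * 'cV[R]_m -> 'cV[R]_p)
    (x : 'cV[R]_n) (y : 'cV[R]_m) :
  differentiable (fun y => f (x, y)) y ->
  (forall i, differentiable (fun y => g (x, y) i 0) y) ->
  Psi f g x y -> GCQ g x y ->
  exists u, [/\ vle 0 u, dot u (g (x, y)) = 0 & grad2_lagrangian f g x y u = 0].
Proof.
move=> df dg Py [_ TE].
(* Inactive constraints contribute the zero vector, which keeps 'I_p as the
   index set; their multipliers, arbitrary in Farkas' lemma, are then reset
   to 0. *)
pose a i := if g (x, y) i 0 == 0 then gradient (fun y => g (x, y) i 0) y else 0.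
have [d ad|u u0 uE] := @farkas_lemma R m p a (- gradient (fun y => f (x, y)) y).
  rewrite dotNl oppr_le0 -diff_dot_gradient //.
  apply: (@tangent_cone_diff_ge0 R m (Gamma g x)) => // [y'|].
    exact: Psi_le.
  by rewrite TE => i gi0; have := ad i; rewrite /a gi0 eqxx.
exists (\col_i (if g (x, y) i 0 == 0 then u i else 0)); split.
- by move=> i; rewrite !mxE; case: ifP.
- rewrite dotE big1 // => i _; rewrite mxE; case: ifP => [/eqP ->|_].
    by rewrite mulr0.
  by rewrite mul0r.
- rewrite grad2_lagrangianE //.
  rewrite -[X in X + _]opprK uE addrC; apply/eqP; rewrite subr_eq0; apply/eqP.
  apply: eq_bigr => i _; rewrite mxE /a; case: ifP => // _.
  by rewrite scale0r scaler0.
Qed.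

Lemma differentiable_section (R : realType) (U V W : normedModType R)
    (h : U * V -> W) (x : U) (y : V) :
  differentiable h (x, y) -> differentiable (fun y => h (x, y)) y.
Proof.
by move=> dh; apply: (@differentiable_comp _ _ _ _ (fun y => (x, y)) h).
Qed.

Theorem theorem4p16 (R : realType) (n m p : nat)
    (f : 'cV[R]_n * 'cV[R]_m -> R)
    (g : 'cV[R]_n * 'cV[R]_m -> 'cV[R]_p)
    (F : 'cV[R]_n * 'cV[R]_m -> R)
    (X : set 'cV[R]_n)
    (f_C2 : C2 f) (g_C2 : C2 g) (F_C1 : C1 F)
    (X_neq0 : X !=set0) (X_closed : closed X)
    (f_convex : forall x, X x ->
       convex_function setT (fun y => f (x, y)))
    (g_convex : forall x, X x -> forall i : 'I_p,
       convex_function setT (fun y => g (x, y) i 0)) :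
  (forall (xb : 'cV[R]_n) (yb : 'cV[R]_m),
     OBOP_minimizer f g F X xb yb ->
     forall (zb : 'cV[R]_m) (ub : 'cV[R]_p), K_mw f g xb yb (zb, ub) ->
     MWD_minimizer f g F X xb yb zb ub)
  /\
  (forall (xb : 'cV[R]_n) (yb zb : 'cV[R]_m) (ub : 'cV[R]_p),
     MWD_minimizer f g F X xb yb zb ub ->
     (forall x, (X `&` dom_Psi f g) x ->
        exists y, Psi f g x y /\ GCQ g x y) ->
     OBOP_minimizer f g F X xb yb).
Proof.
have df x z : differentiable (fun y => f (x, y)) z.
  by apply: differentiable_section; case: f_C2 => -[].
have dg x z i : differentiable (fun y => g (x, y) i 0) z.
  apply: (@differentiable_comp _ _ _ _ (fun y => g (x, y)) (fun w => w i 0)).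
    by apply: differentiable_section; case: g_C2 => -[].
  exact: differentiable_coord.
have weak x y z u : X x -> K_mw f g x y (z, u) -> Psi f g x y.
  by move=> Xx; apply: mw_weak_duality; auto.
split=> [xb yb [[Xxb _] minF] zb ub Kb|xb yb zb ub [[Xxb Kb] minF] gcq].
  split=> // -[[[x y] z] u] [Xx K].
  by apply: (minF (x, y)); split=> //; exact: weak K.
split=> [|[x y] [/= Xx Py]]; first by split=> //; exact: weak Kb.
(* The lower-level solution yh of the qualification may differ from y; it serves
   as the dual variable z. *)
have [|yh [Pyh gcqh]] := gcq x; first by split=> //; exists y.
have [u [u0 ugz gradL0]] := gcq_multiplier (df x yh) (dg x yh) Pyh gcqh.
apply: (minF (x, y, yh, u)); split=> //; split=> //; first by case: Py.
  by apply: Psi_le Py _; case: Pyh.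
by rewrite ugz.
Qed.
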